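(* Let $n\geq 5$. The weight vector $L=(0,3,0,\ldots,0,2,0)$ in $\mathbb{P}^n$ (that is, $l_1=3$, $l_{n-3}=2$, and all other entries $l_i$, $0\le i\le n-2$, equal to $0$: three lines and two linear spaces of codimension $3$) is non-feasible.
   Context: Work over $\mathbb{C}$. A weight vector in $\mathbb{P}^n$ is a vector of non-negative integers $L=(l_0,\ldots,l_{n-2})$. A configuration of linear spaces of weight $L$ is a union of $l_i$ linear spaces of dimension $i$ in $\mathbb{P}^n$, for $i=0,\ldots,n-2$; it is generic if the tuple of its linear components is chosen in a suitable non-empty Zariski open subset of the corresponding product of Grassmannians. A configuration $\Lambda_1\cup\dots\cup\Lambda_t$ is feasible if there is a rational normal curve $\mathcal{C}\subset\mathbb{P}^n$ (a curve projectively equivalent to the degree $n$ Veronese embedding of $\mathbb{P}^1$) such that the scheme $\mathcal{C}\cap\Lambda_i$ has degree $\dim\Lambda_i+1$ for every component $\Lambda_i$. The weight vector $L$ is feasible if a generic configuration of weight $L$ is feasible, and non-feasible otherwise. *)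

(* Defs.v *)
From mathcomp Require Import all_boot all_order all_algebra.
From mathcomp Require Import mpoly complex reals.

Set Implicit Arguments.
Unset Strict Implicit.
Unset Printing Implicit Defensive.

Import GRing.Theory.
Local Open Scope ring_scope.

(* A point of P^n is represented by any of its vectors of homogeneous
   coordinates, and a set of points of P^n by the set of all the nonzero
   vectors that represent its elements. *)

Section Schemes.
Variables (F : fieldType) (n : nat).
Implicit Types (X Y : 'rV[F]_n.+1 -> Prop) (V : {vspace 'rV[F]_n.+1}).

Definition linear_points V : 'rV[F]_n.+1 -> Prop :=
  fun x => x != 0 /\ x \in V.

Definition veronese (s t : F) : 'rV[F]_n.+1 :=
  \row_(j < n.+1) (s ^+ (n - j) * t ^+ j).

Definition rational_normal_curve X : Prop :=
  exists2 A : 'M[F]_n.+1, A \in unitmx &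
    forall x, X x <->
      x != 0 /\ exists c s t : F, x = c *: (veronese s t *m A).

(* Degree m part of the homogeneous ideal of X. *)
Definition vanishing X (m : nat) (p : dhomog n.+1 F m) : Prop :=
  forall x, X x -> (p : {mpoly F[n.+1]}).@[x 0] = 0.

(* Degree m part of I(X) + I(Y), which defines the scheme X \cap Y when X and
   Y are closed subvarieties. *)
Definition cap_ideal X Y (m : nat) (p : dhomog n.+1 F m) : Prop :=
  exists q r : dhomog n.+1 F m,
    [/\ vanishing X q, vanishing Y r & p = q + r].

(* The scheme X \cap Y has dimension at most 0 and degree d: its Hilbert
   polynomial, i.e. dim (S / (I(X) + I(Y)))_m for all large m, is the
   constant d. *)
Definition cap_degree X Y (d : nat) : Prop :=
  exists m0 : nat, forall m : nat, (m0 <= m)%N ->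
    exists2 J : {vspace dhomog n.+1 F m},
      forall p, p \in J <-> cap_ideal X Y p &
      (\dim J + d)%N = \dim {: dhomog n.+1 F m}.

End Schemes.

Section Configurations.
Variables (F : fieldType) (n : nat).

(* The entries of a weight vector are l_0, ..., l_(n-2). *)
Definition weight := 'I_n.-1 -> nat.

Variable L : weight.

(* The component (i, k) is the k-th linear space of dimension i. *)
Definition component : finType := {i : 'I_n.-1 & 'I_(L i)}.

Definition pdim (c : component) : nat := tag c.

Definition grassmannian (d : nat) :=
  {V : {vspace 'rV[F]_n.+1} | \dim V == d.+1}.

Definition configuration := forall c : component, grassmannian (pdim c).

Definition feasible_configuration (Lam : configuration) : Prop :=
  exists2 C : 'rV[F]_n.+1 -> Prop, rational_normal_curve C &
    forall c, cap_degree C (linear_points (val (Lam c))) (pdim c).+1.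

(* A frame is a choice, for every component, of the rows of a matrix as
   spanning vectors. *)
Definition frame := forall c : component, 'M[F]_((pdim c).+1, n.+1).

Definition spans (M : frame) (Lam : configuration) : Prop :=
  forall c, <<[seq row i (M c) | i : 'I_(pdim c).+1]>>%VS = val (Lam c).

Definition entry : finType :=
  {c : component & ('I_(pdim c).+1 * 'I_n.+1)%type}.

Definition coordinates (M : frame) (e : 'I_#|entry|) : F :=
  let: existT c ij := enum_val e in M c ij.1 ij.2.

(* The product of Grassmannians is the quotient of the variety of frames of
   linearly independent vectors by the product of the groups GL_(i+1), with the
   quotient topology: a set is open when its preimage is the complement of the
   zero locus of a set of polynomials in the entries of the frames.  By
   dimension, M is made of linearly independent vectors if spans M Lam. *)
Definition zariski_open (U : configuration -> Prop) : Prop :=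
  exists P : {mpoly F[#|entry|]} -> Prop,
    forall (M : frame) (Lam : configuration), spans M Lam ->
      (U Lam <-> exists2 f, P f & f.@[coordinates M] != 0).

Definition feasible : Prop :=
  exists U : configuration -> Prop,
    [/\ zariski_open U, exists Lam, U Lam &
        forall Lam, U Lam -> feasible_configuration Lam].

Definition non_feasible : Prop := ~ feasible.

End Configurations.

Definition weight_3lines_2codim3 (n : nat) : weight n := fun i =>
  if i == 1%N :> nat then 3%N else if i == (n - 3)%N :> nat then 2%N else 0%N.
Arguments weight_3lines_2codim3 : clear implicits.

(* Main.v *)
From HB Require Import structures.
Require Import Defs.
From mathcomp Require Import all_boot all_order all_algebra.
From mathcomp Require Import complex reals.
From mathcomp Require Import mpoly ring zify.

(* Let Lam_1, Lam_2 be the spaces of codimension 3 and l_1, l_2, l_3 the lines.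
   Write x_j for the equation of the hyperplane spanned by Lam_1 and l_j, and
   y_j for that of the hyperplane spanned by Lam_2 and l_j. Suppose that a
   rational normal curve C is secant to all five spaces. On C = P^1, the forms
   vanishing on a component are the multiples of a binary form: g_a for Lam_a,
   of degree n - 2, and a quadratic form q_j for l_j. Hence x_j = a_j g_1 q_j and
   y_j = b_j g_2 q_j on C. Restriction to the line l_i is reduction modulo q_i,
   where multiplication by q_j has determinant Res(q_i, q_j); so the wedge
   product N_ij of y_j and x_j on l_i is a_j b_j Res(q_i, q_j) t_i, where t_i
   depends on i only. As resultants of quadratic forms are symmetric,
   N_13 N_21 N_32 = N_12 N_23 N_31. This is a polynomial equation in the frames
   of the components, and one explicit configuration violates it. *)

Set Implicit Arguments.
Unset Strict Implicit.
Unset Printing Implicit Defensive.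

Import Order.TTheory GRing.Theory Num.Theory.
Local Open Scope ring_scope.

(** * Polynomials, multivariate forms and spans of rows *)

(** In characteristic 0 the integers below [size p] are distinct, and too many to be all roots. *)
Lemma poly_nonroot (F : numDomainType) (p : {poly F}) :
  p != 0 -> exists x, p.[x] != 0.
Proof.
move=> p0; pose s : seq F := [seq i%:R | i <- iota 0 (size p)].
have /allPn[x _ xp] : ~~ all (root p) s.
  apply/negP => /(max_poly_roots p0).
  rewrite size_map size_iota ltnn => us; suff /us : uniq s by [].
  by rewrite map_inj_uniq ?iota_uniq // => i j /eqP; rewrite eqr_nat => /eqP.
by exists x.
Qed.

Lemma poly_eq0_off0 (F : numDomainType) (p : {poly F}) :
  (forall x, x != 0 -> p.[x] = 0) -> p = 0.
Proof.
move=> p0; apply/eqP/contraT => pN0.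
have [|x] := @poly_nonroot _ (p * 'X); first by rewrite mulf_neq0 ?polyX_eq0.
by rewrite hornerMX; have [->|/p0 ->] := eqVneq x 0; rewrite ?mulr0 ?mul0r eqxx.
Qed.

Lemma bezout_family (F : fieldType) m (p : 'I_m -> {poly F}) :
  exists g k, (forall i, g %| p i) /\ g = \sum_i k i * p i.
Proof.
elim: m p => [|m IHm] p.
  by exists 0, (fun=> 0); split=> [[]|] //; rewrite big_ord0.
have [g [k [gp gE]]] := IHm (fun i => p (lift ord0 i)).
have [[u v] /= Euv] := Bezoutp (p ord0) g.
exists (u * p ord0 + v * g), (fun i => if unlift ord0 i is Some j then v * k j else u).
split=> [i|].
  rewrite (eqp_dvdl _ Euv); case: (unliftP ord0 i) => [j|] ->.
    exact: dvdp_trans (dvdp_gcdr _ _) (gp j).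
  exact: dvdp_gcdl.
rewrite big_ord_recl unlift_none {1}gE mulr_sumr; congr (_ + _).
by apply: eq_bigr => i _; rewrite liftK mulrA.
Qed.

Lemma horner_mmap (F : fieldType) k (h : 'I_k -> {poly F}) (q : {mpoly F[k]}) x :
  (mmap (@polyC F) h q).[x] = q.@[fun i => (h i).[x]].
Proof.
rewrite mevalE /mmap horner_sum; apply: eq_bigr => m _.
rewrite hornerM hornerC horner_prod; congr (_ * _).
by apply: eq_bigr => i _; rewrite horner_exp.
Qed.

Lemma meval_homogZ (F : fieldType) k m (q : {mpoly F[k]}) (c : F) (x y : 'I_k -> F) :
  q \is m.-homog -> (forall i, x i = c * y i) -> q.@[x] = c ^+ m * q.@[y].
Proof.
move=> /dhomogP hq xy; rewrite !mevalE mulr_sumr !big_seq.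
apply: eq_bigr => a /hq <-; rewrite mulrCA; congr (_ * _).
rewrite /= mdegE -prodrXr -big_split /=.
by apply: eq_bigr => i _; rewrite xy exprMn.
Qed.

Lemma size_mul_bound (F : idomainType) (p q : {poly F}) a b :
  (size p <= a.+1)%N -> (size q <= b.+1)%N -> (size (p * q)%R <= (a + b).+1)%N.
Proof.
move=> pa qb; apply: leq_trans (size_polyMleq _ _) _.
by move: pa qb; lia.
Qed.

Lemma size_mmap_homog (F : fieldType) k n m (h : 'I_k -> {poly F}) (q : {mpoly F[k]}) :
  (forall i, size (h i) <= n.+1)%N -> q \is m.-homog ->
  (size (mmap (@polyC F) h q) <= (n * m).+1)%N.
Proof.
move=> hn /dhomogP hq; rewrite /mmap big_seq.
apply: (big_ind (fun p : {poly F} => size p <= (n * m).+1)%N) => [|p r ps rs|a /hq <-].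
- by rewrite size_poly0.
- by apply: leq_trans (size_polyD _ _) _; rewrite geq_max ps.
rewrite mul_polyC; apply: leq_trans (size_scale_leq _ _) _.
rewrite /= mdegE big_distrr /=.
apply: (big_ind2 (fun (p : {poly F}) d => size p <= d.+1)%N) => [|p d r e|i _].
- by rewrite size_poly1.
- exact: size_mul_bound.
elim: (a i) => [|b IHb]; first by rewrite expr0 size_poly1.
by rewrite exprS mulnS; apply: size_mul_bound.
Qed.

Lemma mem_span_rows (F : fieldType) d n (M : 'M[F]_(d, n)) (x : 'rV_n) :
  (x \in <<[seq row i M | i : 'I_d]>>%VS) = (x <= M)%MS.
Proof.
apply/idP/idP => [/(@coord_span _ _ _ (in_tuple _)) -> | /submxP[w ->]].
  apply: summx_sub => i _; apply: scalemx_sub.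
  have /imageP[j _ ->] : (in_tuple [seq row i M | i : 'I_d])`_i \in
      [seq row i M | i : 'I_d] by apply: mem_nth; rewrite /=.
  exact: row_sub.
rewrite mulmx_sum_row; apply: memv_suml => i _.
by apply/memvZ/memv_span/image_f.
Qed.

Lemma dim_span_rows (F : fieldType) d n (M : 'M[F]_(d, n)) :
  row_free M -> \dim <<[seq row i M | i : 'I_d]>>%VS == d.
Proof.
move=> freeM; set X := [seq _ | _ : _].
have sX : size X = d by rewrite size_image card_ord.
suff : free (in_tuple X) by rewrite /free /= sX.
apply/freeP => k k0 i.
have : (\row_j k (cast_ord (esym sX) j)) *m M = 0 *m M.
  rewrite mul0mx mulmx_sum_row -[RHS]k0 (reindex (cast_ord (esym sX))) /=; last first.
    by exists (cast_ord sX) => j _; rewrite ?cast_ordK ?cast_ordKV.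
  apply: eq_bigr => j _; rewrite mxE; congr (_ *: _).
  rewrite (nth_map j) ?size_enum_ord // (_ : nth _ _ _ = j) //.
  by apply: val_inj; rewrite /= nth_enum_ord.
move/(row_free_inj freeM)/rowP/(_ (cast_ord sX i)).
by rewrite !mxE cast_ordK.
Qed.

(** * Rational normal curves *)

Section Curve.
Variables (F : numFieldType) (n : nat).
Implicit Types (A : 'M[F]_n.+1) (v : 'cV[F]_n.+1) (q : {mpoly F[n.+1]}).

Definition curve A (x : 'rV[F]_n.+1) : Prop :=
  x != 0 /\ exists c s t : F, x = c *: (veronese n s t *m A).

(** Column [j] of the matrix holds the binomial expansion of [(s + k * t) ^+ (n - j) * t ^+ j]. *)
Lemma mul_veronese_reparam (k s t : F) :
  veronese n s t *m \matrix_(i, j)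
    (if (j <= i)%N then k ^+ (i - j) *+ 'C(n - j, i - j) else 0)
  = veronese n (s + k * t) t.
Proof.
apply/rowP => j; rewrite !mxE exprDn mulr_suml.
under eq_bigr => i _ do rewrite !mxE.
rewrite -(big_mkord xpredT (fun i => s ^+ (n - i) * t ^+ i *
   (if (j <= i)%N then k ^+ (i - j) *+ 'C(n - j, i - j) else 0))).
rewrite (@big_cat_nat _ _ _ j) ?(ltnW (ltn_ord j)) //=.
rewrite big_nat big1 ?add0r => [|i /andP[_ ij]]; last by rewrite leqNgt ij mulr0.
rewrite -{1}[nat_of_ord j]add0n big_addn.
rewrite subSn; last by rewrite -ltnS.
rewrite -(big_mkord xpredT (fun i =>
  s ^+ (n - j - i) * (k * t) ^+ i *+ 'C(n - j, i) * t ^+ j)).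
apply: eq_bigr => i _; rewrite leq_addl addnK subnDA subnAC.
by rewrite exprMn exprD mulrnAr mulrnAl; congr (_ *+ _); ring.
Qed.

(** The substitution of [s + k * t] for [s] carries the parameter (0 : 1), whose point is the last
    row of the matrix, to (k : 1). A suitable [k] thus puts at infinity a point of the curve off
    given components. *)
Lemma curve_reparam A (k : F) : A \in unitmx ->
  exists B, [/\ B \in unitmx, forall x, curve A x <-> curve B x &
    row ord_max B = veronese n k 1 *m A].
Proof.
move=> uA; set N := \matrix_(i < n.+1, j < n.+1)
    (if (j <= i)%N then k ^+ (i - j) *+ 'C(n - j, i - j) else 0).
have NE s t : veronese n s t *m N = veronese n (s + k * t) t.
  exact: mul_veronese_reparam.
have uN : N \in unitmx.
  rewrite unitmxE det_trig.
    by rewrite big1 ?unitr1 // => i _; rewrite mxE leqnn subnn bin0 expr0.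
  by apply/is_trig_mxP => i j ij; rewrite mxE leqNgt ij.
exists (N *m A); split; first by rewrite unitmx_mul uN.
  move=> x; split=> -[x0 [c [s [t xE]]]]; split=> //.
    by exists c, (s - k * t), t; rewrite mulmxA NE subrK.
  by exists c, (s + k * t), t; rewrite -NE -mulmxA.
(* [veronese n 0 1] is the last unit row, since [0 ^+ (n - j)] is nonzero only for [j = n]. *)
rewrite row_mul; congr (_ *m _); rewrite -(add0r k) -[k in RHS]mulr1 -NE.
rewrite rowE; congr (_ *m _); apply/rowP => j; rewrite !mxE eqxx expr1n mulr1 /=.
have [->|nj] := eqVneq j ord_max; first by rewrite subnn.
rewrite expr0n subn_eq0 leqNgt ltn_neqAle -ltnS ltn_ord andbT.
by rewrite -(inj_eq val_inj) in nj; rewrite nj.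
Qed.

(** Restriction to the curve of the linear form with coefficients [v], in the affine parameter [x]
    of (1 : x). The coefficient of degree [n] is the value at infinity, (0 : 1). *)
Definition pullback A v : {poly F} := rVpoly (A *m v)^T.

Lemma pullback_is_linear A : linear (pullback A).
Proof.
by move=> c u v; rewrite /pullback mulmxDr linearD /= linearD /= -scalemxAr
  linearZ /= linearZ.
Qed.
HB.instance Definition _ A := GRing.isLinear.Build F 'cV[F]_n.+1 {poly F} _
  (pullback A) (pullback_is_linear A).

Lemma size_pullback A v : (size (pullback A v) <= n.+1)%N.
Proof. exact: size_poly. Qed.

Lemma pullback_inv A (p : {poly F}) : A \in unitmx -> (size p <= n.+1)%N ->
  pullback A (invmx A *m (poly_rV p)^T) = p.
Proof. by move=> uA sp; rewrite /pullback mulKVmx // trmxK poly_rV_K. Qed.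

Lemma pullback_inj A : A \in unitmx -> injective (pullback A).
Proof.
move=> uA u v /(can_inj rVpolyK) /trmx_inj.
by move/(congr1 (mulmx (invmx A))); rewrite !mulKmx.
Qed.

Lemma horner_pullback A v (x : F) :
  (pullback A v).[x] = (veronese n 1 x *m A *m v) 0 0.
Proof.
rewrite /pullback horner_poly -mulmxA mxE; apply: eq_bigr => i _.
by rewrite valK mulrC [_^T _ _]mxE [veronese _ _ _ _ _]mxE expr1n mul1r.
Qed.

Definition pullback_mpoly A q : {poly F} :=
  mmap (@polyC F) (fun j => pullback A (delta_mx j 0)) q.

Definition linear_form v : {mpoly F[n.+1]} := \sum_i v i 0 *: 'X_i.

Lemma linear_form_homog v : linear_form v \is 1.-homog.
Proof. by apply: rpred_sum => i _; apply: rpredZ; rewrite dhomogX /= mdeg1. Qed.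

Lemma meval_linear_form v (x : 'rV_n.+1) : (linear_form v).@[x 0] = (x *m v) 0 0.
Proof.
rewrite linear_sum mxE; apply: eq_bigr => i _.
by rewrite /= mevalZ mevalXU mulrC.
Qed.

Lemma pullback_linear_form A v : pullback_mpoly A (linear_form v) = pullback A v.
Proof.
rewrite /pullback_mpoly raddf_sum /=.
rewrite {2}(_ : v = \sum_j v j 0 *: delta_mx j 0) ?linear_sum.
  by apply: eq_bigr => i _; rewrite mmapZ mmapX mmap1U linearZ mul_polyC.
rewrite {1}[v]matrix_sum_delta; apply: eq_bigr => i _.
by rewrite big_ord1.
Qed.

(** Projective normality of the rational normal curve: ['X^k] is ['X^a], the pullback of a linear
    form for [a = minn k n], times a power covered by induction on the degree. *)
Lemma pullback_mpoly_surj A m (h : {poly F}) : A \in unitmx ->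
  (size h <= (n * m).+1)%N -> exists2 q, q \is m.-homog & pullback_mpoly A q = h.
Proof.
move=> uA hm; pose P (p : {poly F}) := exists2 q, q \is m.-homog & pullback_mpoly A q = p.
suff PX k : (k <= n * m)%N -> P 'X^k.
  rewrite -(coefK h) poly_def -/(P _).
  apply: (big_ind P) => [|_ _ [p hp <-] [q hq <-]|i _].
  - by exists 0; rewrite ?rpred0 // /pullback_mpoly raddf0.
  - by exists (p + q); rewrite ?rpredD // /pullback_mpoly mmapD.
  have [|q hq qE] := PX i; first by rewrite -ltnS (leq_trans _ hm).
  by exists (h`_i *: q); rewrite ?rpredZ // /pullback_mpoly mmapZ mul_polyC -qE.
rewrite {}/P; elim: m k {hm} => [|m IHm] k.
  rewrite muln0 leqn0 => /eqP ->.
  by exists 1; [exact: dhomog1 | rewrite /pullback_mpoly rmorph1].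
rewrite mulnS => kn; pose a := minn k n.
have [|q hq qE] := IHm (k - a)%N; first by rewrite /a; lia.
exists (linear_form (invmx A *m (poly_rV 'X^a)^T) * q).
  by apply: (dhomogM (d := 1%N)) => //; exact: linear_form_homog.
rewrite /pullback_mpoly rmorphM /= -/(pullback_mpoly _ _) pullback_linear_form.
rewrite pullback_inv ?size_polyXn ?ltnS ?geq_minr // -/(pullback_mpoly A q) qE.
by rewrite -exprD subnKC ?geq_minl.
Qed.

Lemma pullback_mpoly_eq0 A m q x : q \is m.-homog ->
  pullback_mpoly A q = 0 -> curve A x -> q.@[x 0] = 0.
Proof.
move=> hq q0 [_ [c [s [t ->]]]].
rewrite (meval_homogZ (c := c) (y := (veronese n s t *m A) 0) hq); last first.
  by move=> i; rewrite mxE.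
(* Homogeneity reduces [s' != 0] to the parameter (1 : t / s'), where the pullback is evaluated. The
   case [s = 0] follows because a polynomial in [s] that vanishes off 0 is zero. *)
suff V s' : s' != 0 -> q.@[(veronese n s' t *m A) 0] = 0.
  have [->|/V ->] := eqVneq s 0; last by rewrite mulr0.
  pose h (j : 'I_n.+1) : {poly F} := \sum_(i < n.+1) 'X^(n - i) * (t ^+ i * A i j)%:P.
  have hE y : (mmap (@polyC F) h q).[y] = q.@[(veronese n y t *m A) 0].
    rewrite horner_mmap; apply: meval_eq => j; rewrite mxE /h horner_sum.
    by apply: eq_bigr => i _; rewrite !hornerE mxE.
  by rewrite -hE (poly_eq0_off0 (p := mmap _ _ _)) ?horner0 ?mulr0 // => y /V; rewrite hE.
move=> s0; rewrite (meval_homogZ (c := s' ^+ n) (y := (veronese n 1 (t / s') *m A) 0) hq).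
  suff <- : (pullback_mpoly A q).[t / s'] = q.@[(veronese n 1 (t / s') *m A) 0].
    by rewrite q0 horner0 mulr0.
  rewrite /pullback_mpoly horner_mmap; apply: meval_eq => j.
  by rewrite horner_pullback -colE mxE.
move=> j; rewrite !mxE mulr_sumr; apply: eq_bigr => i _.
rewrite !mxE expr1n mul1r expr_div_n mulrA; congr (_ * _).
have -> : s' ^+ n = s' ^+ (n - i) * s' ^+ i by rewrite -exprD subnK // -ltnS.
by rewrite -mulrA; congr (_ * _); rewrite mulrCA mulfV ?mulr1 // expf_neq0.
Qed.

End Curve.

(** * Equations of secant components *)

(** The target has dimension the degree of [g], which bounds the codimension of the forms whose
    pullback is divisible by [g]. *)
Definition residue (F : numFieldType) n (A : 'M[F]_n.+1) (g : {poly F}) m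
    (p : dhomog n.+1 F m) : 'rV[F]_(size g).-1 :=
  poly_rV (pullback_mpoly A p %% g).

Lemma residue_is_linear (F : numFieldType) n (A : 'M[F]_n.+1) g m :
  linear (@residue F n A g m).
Proof.
move=> c p q; rewrite /residue linearP /= /pullback_mpoly mmapD mmapZ mul_polyC.
by rewrite modpD modpZl linearP.
Qed.
HB.instance Definition _ (F : numFieldType) n A (g : {poly F}) m :=
  GRing.isLinear.Build F (dhomog n.+1 F m) 'rV[F]_(size g).-1 _
    (@residue F n A g m) (@residue_is_linear F n A g m).

Section Secant.
Variables (F : numFieldType) (n d : nat).
Variables (A : 'M[F]_n.+1) (M : 'M[F]_(d.+1, n.+1)) (X : 'rV[F]_n.+1 -> Prop).
Implicit Types v : 'cV[F]_n.+1.
Variable vinf : 'cV[F]_n.+1.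
Hypotheses (uA : A \in unitmx) (XA : forall x, X x <-> curve A x).
(* The point at infinity of the curve, [row ord_max A], is not on the component. *)
Hypotheses (Mvinf : M *m vinf = 0) (vinf_max : (A *m vinf) ord_max 0 != 0).

Local Notation Lam := <<[seq row i M | i : 'I_d.+1]>>%VS.

Lemma size_pullback_vinf : size (pullback A vinf) = n.+1.
Proof.
apply/eqP; rewrite eqn_leq size_pullback ltnNge; apply/negP => /leq_sizeP/(_ n).
rewrite leqnn => /(_ isT)/eqP; apply/negP; rewrite /pullback.
by rewrite (coef_rVpoly_ord _ ord_max) mxE.
Qed.

Lemma linear_form_vanishing v (x : 'rV_n.+1) :
  M *m v = 0 -> linear_points Lam x -> (linear_form v).@[x 0] = 0.
Proof.
move=> Mv [_]; rewrite mem_span_rows => /submxP[y ->].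
by rewrite meval_linear_form -mulmxA Mv mulmx0 mxE.
Qed.

(* Division by the pullback of [vinf], whose degree is exactly [n], keeps the
   degrees in the Bezout relation [g = \sum_i k i * pullback A (w i)] low
   enough for all cofactors to come from forms of degree [m.-1]. *)
Lemma cap_ideal_dvd a (w : 'I_a -> 'cV[F]_n.+1) (k : 'I_a -> {poly F}) m
    (p : dhomog n.+1 F m) :
  (forall i, M *m w i = 0) -> (1 < m)%N ->
  \sum_i k i * pullback A (w i) %| pullback_mpoly A p ->
  cap_ideal X (linear_points Lam) p.
Proof.
move=> Mw m1 /dvdpP[h pE]; pose f := pullback A vinf.
have sf : size f = n.+1 := size_pullback_vinf.
have f0 : f != 0 by rewrite -size_poly_gt0 sf.
(* Each [h * k i] is reduced modulo [f]; the quotients are collected in [c], the cofactor of [f]. *)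
pose c := \sum_i (h * k i) %/ f * pullback A (w i).
have {}pE : pullback_mpoly A p =
    \sum_i (h * k i) %% f * pullback A (w i) + f * c.
  rewrite pE /c !mulr_sumr -big_split; apply: eq_bigr => i _ /=.
  by rewrite mulrA {1}(divp_eq (h * k i) f); ring.
have sr i : (size ((h * k i) %% f)%R <= n)%N by rewrite -ltnS -sf ltn_modp.
have n_le : (n <= n * m.-1)%N by rewrite leq_pmulr //; lia.
have sp : (size (pullback_mpoly A p) <= (n * m).+1)%N.
  by apply: size_mmap_homog => [i|]; [exact: size_pullback | exact: dhomog_is_dhomog].
have nm : (n * m = n + n * m.-1)%N by rewrite -mulnS prednK // ltnW.
(* [f * c] is a difference of polynomials of degree at most [n * m], and [f] has degree [n]. *)
have sc : (size c <= (n * m.-1).+1)%N.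
  have [->|c0] := eqVneq c 0; first by rewrite size_poly0.
  have : (size (f * c)%R <= (n * m).+1)%N.
    rewrite (_ : f * c = pullback_mpoly A p - \sum_i (h * k i) %% f * pullback A (w i)).
      apply: leq_trans (size_polyD _ _) _; rewrite geq_max sp size_polyN.
      apply: leq_trans (size_sum _ _ _) _; apply/bigmax_leqP => i _.
      apply: leq_trans (size_polyMleq _ _) _.
      rewrite -subn1 leq_subLR; apply: leq_trans (leq_add (sr i) (size_pullback A (w i))) _.
      by rewrite nm addnS add1n !ltnS leqW // leq_add2l.
    by rewrite pE [X in _ = X - _]addrC addrK.
  by rewrite size_mul // sf nm addSn /= -addnS leq_add2l.
have [qc hqc qcE] := pullback_mpoly_surj uA sc.
have lift i : exists q, q \is m.-1.-homog /\ pullback_mpoly A q = (h * k i) %% f.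
  have [|q ? ?] := @pullback_mpoly_surj F n A m.-1 ((h * k i) %% f) uA.
    by apply: leq_trans (sr i) _; rewrite leqW.
  by exists q.
have [q hq] := fin_all_exists lift.
pose r := \sum_i linear_form (w i) * q i + linear_form vinf * qc.
have hM v s : s \is m.-1.-homog -> linear_form v * s \is m.-homog.
  by move=> hs; rewrite -(prednK (ltnW m1)); apply: (dhomogM (d := 1%N)) => //;
    exact: linear_form_homog.
have hr : r \is m.-homog.
  apply: rpredD; last exact: hM.
  by apply: rpred_sum => i _; have [hqi _] := hq i; exact: hM.
have rE : pullback_mpoly A r = pullback_mpoly A p.
  rewrite pE /r /pullback_mpoly rmorphD rmorphM raddf_sum /= -!/(pullback_mpoly _ _).
  rewrite qcE pullback_linear_form; congr (_ + _); apply: eq_bigr => i _.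
  rewrite rmorphM /= -!/(pullback_mpoly _ _) pullback_linear_form mulrC.
  by have [_ ->] := hq i.
(* [p - r] pulls back to 0, hence vanishes on the curve; every term of [r] has a linear factor
   vanishing on the component. *)
exists (p - DHomog hr), (DHomog hr); split; last by rewrite subrK.
  move=> x /XA Cx; apply: (pullback_mpoly_eq0 (m := m)) Cx; first exact: dhomog_is_dhomog.
  by rewrite raddfB /= /pullback_mpoly mmapB -!/(pullback_mpoly _ _) rE subrr.
move=> x Lx; rewrite /= mevalD mevalM (linear_form_vanishing Mvinf Lx) mul0r addr0.
rewrite raddf_sum big1 // => i _ /=.
by rewrite mevalM (linear_form_vanishing (Mw i) Lx) mul0r.
Qed.

(** In large degree the ideal has codimension [e] and contains the kernel of the residue map, whose
    codimension is at most the degree of [g]. *)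
Lemma cap_degree_leq e (g : {poly F}) : g != 0 ->
  (forall m (p : dhomog n.+1 F m), (1 < m)%N -> g %| pullback_mpoly A p ->
     cap_ideal X (linear_points Lam) p) ->
  cap_degree X (linear_points Lam) e -> (e < size g)%N.
Proof.
move=> g0 capJ [m0 /(_ (maxn m0 2))]; set m := maxn _ _.
rewrite leq_maxl => -[//|J JE dimJ].
pose Theta := linfun (residue A g (m := m)).
have kerJ : (lker Theta <= J)%VS.
  apply/subvP => p; rewrite memv_ker lfunE => /eqP p0; apply/JE/capJ.
    by rewrite leq_maxr.
  rewrite /dvdp -(@poly_rV_K _ (size g).-1 (_ %% g)).
    by move: p0; rewrite /= /residue => ->; rewrite linear0.
  by rewrite -ltnS prednK ?size_poly_gt0 // ltn_modp.
have := limg_ker_dim Theta fullv; rewrite capfv -dimJ => dimE.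
have := dimvS (subvf (limg Theta)); rewrite [leqRHS]dimvf /dim /= mul1n => le_limg.
rewrite -ltnS in le_limg; rewrite prednK ?size_poly_gt0 // in le_limg.
apply: leq_ltn_trans le_limg; rewrite -(leq_add2l (\dim J)) -dimE leq_add2r.
exact: dimvS.
Qed.
Lemma ker_pullback_sub v : (v^T <= kermx M^T)%MS = (M *m v == 0).
Proof. by rewrite sub_kermx -trmx_mul (can2_eq trmxK trmxK) trmx0. Qed.

(* The pullbacks of the forms vanishing on the component have a gcd of degree
   at least [d.+1]; comparing dimensions, they are all its multiples. *)
Lemma secant_equation : row_free M -> cap_degree X (linear_points Lam) d.+1 ->
  exists g : {poly F}, [/\ g \is monic, size g = d.+2 &
    forall v, M *m v = 0 <-> g %| pullback A v].
Proof.
move=> freeM degX.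
(* The rows of [kermx M^T] span the linear forms vanishing on the component. *)
pose K i := (row i (kermx M^T))^T.
have [g [k [gK gE]]] := bezout_family (fun i => pullback A (K i)).
have MK i : M *m K i = 0 by apply/eqP; rewrite -ker_pullback_sub trmxK row_sub.
have gM v : M *m v = 0 -> g %| pullback A v.
  move/eqP; rewrite -ker_pullback_sub => /submxP[y /(congr1 trmx)].
  rewrite trmxK mulmx_sum_row => ->; rewrite !linear_sum /=.
  apply: (big_ind (fun p : {poly F} => g %| p)) => [|p q gp gq|i _].
  - exact: dvdp0.
  - exact: dvdp_add.
  by rewrite !linearZ /= -mul_polyC; apply/dvdp_mull/gK.
have f0 : pullback A vinf != 0 by rewrite -size_poly_gt0 size_pullback_vinf.
have g0 : g != 0 by apply: contraNneq f0 => g0; rewrite -dvd0p -g0 gM.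
have lt_d_g : (d.+1 < size g)%N.
  apply: cap_degree_leq degX => // m p m1; rewrite gE; exact: cap_ideal_dvd.
have le_g_n : (size g <= n.+1)%N by rewrite -size_pullback_vinf dvdp_leq ?gM.
(* [e] is the dimension of the multiples of [g] of degree at most [n]; the rows of [G] are the
   linear forms that pull back to [g * 'X^i]. *)
pose e := (n.+1 - (size g).-1)%N.
pose G : 'M[F]_(e, n.+1) := \matrix_(i < e) (invmx A *m (poly_rV (g * 'X^i))^T)^T.
have sub_G v : g %| pullback A v -> (v^T <= G)%MS.
  have [->|v0] := eqVneq v 0; first by rewrite trmx0 sub0mx.
  move=> /dvdpP[h hE].
  have sh : (size h <= e)%N.
    have h0 : h != 0.
      apply: contraNneq v0 => h0; apply/eqP/(pullback_inj uA).
      by rewrite hE h0 mul0r linear0.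
    have := size_pullback A v; rewrite hE size_mul // /e.
    have : (0 < size g)%N by rewrite size_poly_gt0.
    by move: (size h) (size g) => a b; lia.
  have -> : v = \sum_(i < e) h`_i *: (invmx A *m (poly_rV (g * 'X^i))^T).
    apply: (pullback_inj uA); rewrite hE linear_sum /= -{1}(coefK h) poly_def mulr_suml.
    rewrite (big_ord_widen e (fun i => h`_i *: 'X^i * g)) // big_mkcond /=.
    apply: eq_bigr => i _; rewrite linearZ /= pullback_inv //.
      case: ltnP => [_|/leq_sizeP/(_ i (leqnn i)) ->]; last by rewrite scale0r.
      by rewrite -scalerAl mulrC.
    rewrite size_mul ?expf_neq0 ?polyX_eq0 // size_polyXn.
    by have := ltn_ord i; rewrite {2}/e addnS /=; move: (size g) lt_d_g; lia.
  rewrite linear_sum; apply: summx_sub => i _; rewrite linearZ /=.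
  by apply: scalemx_sub; have := row_sub i G; rewrite rowK.
have sub_kerG : (kermx M^T <= G)%MS.
  by apply/row_subP => i; rewrite -[row _ _]trmxK; apply/sub_G/gM/MK.
have rk_ker : \rank (kermx M^T) = (n - d)%N.
  by rewrite mxrank_ker mxrank_tr (eqP freeM) subSS.
(* The [n - d] independent equations of the component lie in the row space of [G], of dimension at
   most [e]. This bounds the degree of [g] by [d.+1]; the two spaces then have equal dimension. *)
have sg : size g = d.+2.
  apply/eqP; rewrite eqn_leq lt_d_g andbT.
  have := leq_trans (mxrankS sub_kerG) (rank_leq_row G); rewrite rk_ker /e.
  by move: (size g) lt_d_g le_g_n; lia.
have sub_Gker : (G <= kermx M^T)%MS.
  rewrite -(mxrank_leqif_sup sub_kerG) eqn_leq mxrankS //=.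
  by apply: leq_trans (rank_leq_row G) _; rewrite rk_ker /e sg subSS.
exists ((lead_coef g)^-1 *: g); split.
- by rewrite monicE lead_coefZ mulVf // lead_coef_eq0.
- by rewrite size_scale // invr_eq0 lead_coef_eq0.
move=> v; rewrite dvdpZl ?invr_eq0 ?lead_coef_eq0 //; split; first exact: gM.
by move/sub_G/submx_trans/(_ sub_Gker); rewrite ker_pullback_sub => /eqP.
Qed.

End Secant.

(** * The obstruction *)

Section QuadraticResidues.
Variable F : fieldType.
Implicit Types p q r f h : {poly F}.

(* The resultant of two monic quadratic polynomials. *)
Definition quad_res q r : F :=
  (r`_0 - q`_0) ^+ 2 + (r`_1 - q`_1) * (r`_1 * q`_0 - q`_1 * r`_0).

Lemma quad_resC q r : quad_res q r = quad_res r q.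
Proof. by rewrite /quad_res; ring. Qed.

(** For quadratic [q], the determinant of the classes of [f] and [h] in the basis 1, ['X] of the
    quotient by [q]. *)
Definition mod_bracket q f h : F :=
  (f %% q)`_0 * (h %% q)`_1 - (f %% q)`_1 * (h %% q)`_0.

Lemma size2_poly p : (size p <= 2)%N -> p = (p`_0)%:P + (p`_1)%:P * 'X.
Proof.
move=> p2; apply/polyP => -[|[|i]]; rewrite coefD coefC coefMX coefC /= ?addr0 ?add0r //.
by rewrite nth_default // (leq_trans p2).
Qed.

Lemma monic_quadratic q : q \is monic -> size q = 3%N ->
  q = 'X^2 + (q`_1)%:P * 'X + (q`_0)%:P.
Proof.
move=> /monicP; rewrite /lead_coef => + q3; rewrite q3 /= => q2.
apply/polyP => -[|[|[|i]]]; rewrite !coefD coefXn coefMX !coefC /= ?add0r ?addr0 //.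
by rewrite nth_default // q3.
Qed.

(** Both polynomials being monic, [r] is congruent to the linear [r - q], with coefficients [a] and
    [b]; the square of ['X] is then reduced by [q]. *)
Lemma modp_mul_quadratic q r f (a := r`_0 - q`_0) (b := r`_1 - q`_1)
    (c := (f %% q)`_0) (d := (f %% q)`_1) :
  q \is monic -> size q = 3%N -> r \is monic -> size r = 3%N ->
  (r * f) %% q = (a * c - q`_0 * b * d)%:P + (a * d + b * c - q`_1 * b * d)%:P * 'X.
Proof.
move=> mq q3 mr r3; set s := RHS.
have s_small : (size s < size q)%N.
  rewrite q3 ltnS; apply: leq_trans (size_polyD _ _) _; rewrite geq_max.
  rewrite (leq_trans (size_polyC_leq1 _)) //= mul_polyC.
  by apply: leq_trans (size_scale_leq _ _) _; rewrite size_polyX.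
pose K := f %/ q * r + (c%:P + d%:P * 'X) + (b * d)%:P.
suff -> : r * f = K * q + s by rewrite modp_addl_mul_small.
have fE : f = f %/ q * q + (c%:P + d%:P * 'X).
  rewrite {1}(divp_eq f q) -size2_poly // -ltnS -q3 ltn_modp.
  by rewrite -size_poly_gt0 q3.
rewrite {1}fE /K mulrDr !mulrDl -!addrA; congr (_ + _); first by ring.
rewrite /s (monic_quadratic mq q3) {1}(monic_quadratic mr r3).
rewrite !(coefD, coefXn, coefMX, coefC) /= ?(add0r, addr0) /a /b.
by ring.
Qed.

Lemma mod_bracket_mul q r f h :
  q \is monic -> size q = 3%N -> r \is monic -> size r = 3%N ->
  mod_bracket q (r * f) (r * h) = quad_res q r * mod_bracket q f h.
Proof.
move=> mq q3 mr r3; rewrite /mod_bracket !modp_mul_quadratic //.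
rewrite !(coefD, coefC, coefMX) /= ?(add0r, addr0) /quad_res.
by ring.
Qed.
End QuadraticResidues.

(** * The obstruction as a polynomial in the frames *)

Section Forms.
Variables (R : comNzRingType) (k : nat).
Implicit Types (L : 'M[R]_(k.+1, k.+4)) (Q : 'M[R]_(2, k.+4)) (z : 'rV[R]_k.+4).

(** As a function of [z], an equation of the hyperplane spanned by [Q] and [L]; identically zero
    when their rows are dependent. *)
Definition line_form L Q z : R :=
  \det (col_mx z (col_mx Q L) : 'M_(1 + (2 + k.+1), k.+4)).

(** Cofactors along the first row do not depend on it, so 0 stands in for [z]. *)
Definition line_form_coefs L Q : 'cV[R]_k.+4 :=
  \col_j cofactor (col_mx 0 (col_mx Q L) : 'M_(1 + (2 + k.+1), k.+4)) ord0 j.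

Lemma line_formE L Q z : line_form L Q z = (z *m line_form_coefs L Q) 0 0.
Proof.
rewrite /line_form (expand_det_row _ ord0) mxE; apply: eq_bigr => j _.
have row'E (y : 'rV_k.+4) i l : row' ord0
    (col' j (col_mx y (col_mx Q L) : 'M_(1 + (2 + k.+1), k.+4))) i l
    = col_mx Q L i (lift j l).
  by rewrite [LHS]mxE [LHS]mxE -rshift1; exact: col_mxEd.
congr (_ * _).
  transitivity (col_mx z (col_mx Q L) (lshift _ 0) j); last exact: col_mxEu.
  by congr (_ _ j); exact: val_inj.
rewrite mxE /cofactor; congr (_ * \det _).
by apply/matrixP => i l; rewrite !row'E.
Qed.

Lemma line_form_coefs0 L Q : col_mx Q L *m line_form_coefs L Q = 0.
Proof.
apply/matrixP => i j; rewrite (ord1 j) [RHS]mxE.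
have -> : (col_mx Q L *m line_form_coefs L Q) i 0 =
    line_form L Q (row i (col_mx Q L)).
  by rewrite line_formE -row_mul [RHS]mxE.
apply: (determinant_alternate (i1 := lshift _ 0) (i2 := rshift _ i)).
  by rewrite eq_lrshift.
by move=> l; rewrite col_mxEu col_mxEd mxE.
Qed.

(** This is [N_ij] for [Q] the line [l_i] and [Q'] the line [l_j], computed on the two points that
    span [l_i]. *)
Definition line_bracket L1 L2 Q Q' : R :=
  line_form L2 Q' (row 0 Q) * line_form L1 Q' (row 1 Q)
  - line_form L2 Q' (row 1 Q) * line_form L1 Q' (row 0 Q).

Definition obstruction L1 L2 Q1 Q2 Q3 : R :=
  line_bracket L1 L2 Q1 Q3 * line_bracket L1 L2 Q2 Q1 * line_bracket L1 L2 Q3 Q2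
  - line_bracket L1 L2 Q1 Q2 * line_bracket L1 L2 Q2 Q3 * line_bracket L1 L2 Q3 Q1.

End Forms.

Lemma row_free_col_mx (F : fieldType) m1 m2 n (U : 'M[F]_(m1, n)) (V : 'M_(m2, n)) :
  row_free (col_mx U V) -> row_free U /\ row_free V.
Proof.
move=> UV; split; apply: inj_row_free => y yU.
  have : row_mx y 0 *m col_mx U V = 0 *m col_mx U V.
    by rewrite mul_row_col yU !mul0mx addr0.
  by move/(row_free_inj UV)/eqP; rewrite row_mx_eq0 => /andP[/eqP].
have : row_mx 0 y *m col_mx U V = 0 *m col_mx U V.
  by rewrite mul_row_col yU !mul0mx addr0.
by move/(row_free_inj UV)/eqP; rewrite row_mx_eq0 => /andP[_ /eqP].
Qed.

Lemma row_free_col_mx_disjoint (F : fieldType) m1 m2 n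
    (U : 'M[F]_(m1, n)) (V : 'M_(m2, n)) (x : 'rV_n) :
  row_free (col_mx U V) -> (x <= U)%MS -> (x <= V)%MS -> x = 0.
Proof.
move=> UV /submxP[y xU] /submxP[y' xV].
have : row_mx y (- y') *m col_mx U V = 0 *m col_mx U V.
  by rewrite mul_row_col mulNmx -xU -xV subrr mul0mx.
move/(row_free_inj UV)/eqP; rewrite row_mx_eq0 => /andP[/eqP y0 _].
by rewrite xU y0 mul0mx.
Qed.

Lemma line_form_row_free (F : fieldType) k (L : 'M[F]_(k.+1, k.+4)) Q z :
  line_form L Q z != 0 -> row_free (col_mx Q L).
Proof.
rewrite -unitfE -unitmxE -row_free_unit => zQL.
by have [_] := @row_free_col_mx F 1 (2 + k.+1) k.+4 z (col_mx Q L) zQL.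
Qed.

Lemma line_bracket_row_free (F : fieldType) k (L1 L2 : 'M[F]_(k.+1, k.+4)) Q Q' :
  line_bracket L1 L2 Q Q' != 0 -> row_free (col_mx Q' L1) /\ row_free (col_mx Q' L2).
Proof.
have zero L z : ~~ row_free (col_mx Q' L) -> line_form L Q' z = 0.
  by move=> nfree; apply/eqP; apply: contraNT nfree; exact: line_form_row_free.
by move=> br; split; apply: contraNT br => nfree;
  rewrite /line_bracket !(zero _ _ nfree) ?mulr0 ?mul0r subrr.
Qed.

(** In each of the two products every line is the second argument of a bracket, and such a bracket
    vanishes when that line and one of the spaces are dependent. Nonvanishing thus carries the
    general position that the argument uses. *)
Lemma obstruction_row_free (F : fieldType) k (L1 L2 : 'M[F]_(k.+1, k.+4)) Q1 Q2 Q3 :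
  obstruction L1 L2 Q1 Q2 Q3 != 0 ->
  [/\ row_free (col_mx Q1 L1) /\ row_free (col_mx Q1 L2),
      row_free (col_mx Q2 L1) /\ row_free (col_mx Q2 L2) &
      row_free (col_mx Q3 L1) /\ row_free (col_mx Q3 L2)].
Proof.
move=> ob.
pose N := line_bracket L1 L2.
have : (N Q1 Q3 * N Q2 Q1 * N Q3 Q2 != 0) || (N Q1 Q2 * N Q2 Q3 * N Q3 Q1 != 0).
  apply: contraNT ob; rewrite negb_or !negbK /obstruction => /andP[/eqP-> /eqP->].
  by rewrite subrr.
rewrite !mulf_eq0 !negb_or -!andbA.
by case/orP => /and3P[]; do 3 ![move/line_bracket_row_free=> ?].
Qed.

Lemma sub_row_annihilator (F : fieldType) m n (M : 'M[F]_(m, n)) (x : 'rV_n) :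
  (forall v : 'cV_n, M *m v = 0 -> x *m v = 0) -> (x <= M)%MS.
Proof.
move=> xM; rewrite submxE; apply/eqP/matrixP => i j.
have := xM (col j (cokermx M)).
rewrite colE (mulmxA M) (mulmxA x) mulmx_coker mul0mx -colE => /(_ erefl)/colP/(_ i).
by rewrite mxE => ->; rewrite !mxE.
Qed.

Lemma exists_annihilator (F : fieldType) m n (M : 'M[F]_(m, n)) :
  (m < n)%N -> exists2 v : 'cV_n, v != 0 & M *m v = 0.
Proof.
move=> mn; have : cokermx M != 0.
  by rewrite -mxrank_eq0 mxrank_coker subn_eq0 -ltnNge (leq_ltn_trans (rank_leq_row M)).
case/matrix0Pn => i [j ij]; exists (col j (cokermx M)).
  by apply/matrix0Pn; exists i, 0; rewrite mxE.
by rewrite colE (mulmxA M) mulmx_coker mul0mx.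
Qed.

(* [veronese n k 1 *m A] is the point that [curve_reparam] moves to infinity. *)
Lemma veronese_avoids (F : numFieldType) n m (A : 'M[F]_n.+1) (M : 'M_(m, n.+1)) :
  A \in unitmx -> (m < n.+1)%N ->
  exists2 p : {poly F}, p != 0 & forall k, p.[k] != 0 ->
    exists2 v : 'cV_n.+1, M *m v = 0 & (veronese n k 1 *m A *m v) 0 0 != 0.
Proof.
move=> uA /(exists_annihilator M)[v v0 Mv].
(* The value at [k] is that of the form [v] at the parameter (k : 1); the coefficients are the
   entries of [A *m v] in reverse order. *)
pose p : {poly F} := \sum_(j < n.+1) (A *m v) j 0 *: 'X^(n - j).
exists p => [|k]; last first.
  suff -> : p.[k] = (veronese n k 1 *m A *m v) 0 0 by exists v.
  rewrite -mulmxA mxE horner_sum; apply: eq_bigr => j _.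
  by rewrite hornerZ hornerXn !mxE expr1n mulr1 mulrC.
have : A *m v != 0 by apply: contraNneq v0 => Av; rewrite -(mulKmx uA v) Av mulmx0.
case/matrix0Pn => j [i ij]; apply: contraNneq ij => p0; rewrite (ord1 i).
have <- : p`_(n - j) = 0 by rewrite p0 coef0.
apply/eqP.
rewrite coef_sum (bigD1 j) //= coefZ coefXn eqxx mulr1 big1 ?addr0 // => l lj.
rewrite coefZ coefXn (_ : (_ == _) = false) ?mulr0 //.
apply: contraNF lj => /eqP; rewrite -(inj_eq val_inj) /=.
by have := ltn_ord j; have := ltn_ord l; lia.
Qed.

(** * Vanishing of the obstruction on secant configurations *)

Section Relation.
Variables (F : numClosedFieldType) (k : nat) (A : 'M[F]_k.+4).
Hypothesis uA : A \in unitmx.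
Implicit Types (L : 'M[F]_(k.+1, k.+4)) (Q : 'M[F]_(2, k.+4)).

Definition cut_out d (M : 'M[F]_(d.+1, k.+4)) (g : {poly F}) :=
  [/\ g \is monic, size g = d.+2 & forall v, M *m v = 0 <-> g %| pullback A v].

Lemma cut_out_root d (M : 'M[F]_(d.+1, k.+4)) g x :
  cut_out M g -> root g x -> (veronese k.+3 1 x *m A <= M)%MS.
Proof.
move=> [_ _ gM] /rootP gx; apply: sub_row_annihilator => v /gM /dvdpP[h hE].
have vx : (pullback A v).[x] = 0 by rewrite hE hornerM gx mulr0.
by apply/matrixP => i j; rewrite !ord1 -horner_pullback vx mxE.
Qed.

(** Over an algebraically closed field it suffices to exclude common roots; the point of the curve
    at such a root would lie in both spans, which meet only in 0. *)
Lemma cut_out_coprime L Q g q :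
  row_free (col_mx Q L) -> cut_out L g -> cut_out Q q -> coprimep g q.
Proof.
move=> QL gL qQ; apply/Pdiv.ClosedField.root_coprimep => x gx.
apply/negP => qx; have /row_free_col_mx_disjoint := QL.
move=> /(_ _ (cut_out_root qQ qx) (cut_out_root gL gx)).
move/(congr1 (fun y => y *m invmx A)); rewrite mulmxK // mul0mx => /rowP/(_ 0).
by rewrite !mxE expr0 expr1n mulr1 => /eqP; rewrite oner_eq0.
Qed.

(** The coprime [q] and [g] both divide the pullback, and their degrees 2 and [k.+1] add up to the
    maximal degree [k.+3], so the cofactor is constant. *)
Lemma pullback_line_form L Q g q :
  row_free (col_mx Q L) -> cut_out L g -> cut_out Q q ->
  exists a, pullback A (line_form_coefs L Q) = a *: (q * g).
Proof.
move=> QL gL qQ; have gq := cut_out_coprime QL gL qQ.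
have [mg sg gM] := gL; have [mq sq qM] := qQ.
have /eqP := line_form_coefs0 L Q.
rewrite mul_col_mx col_mx_eq0 => /andP[/eqP/qM qv /eqP/gM gv].
have /dvdpP[h hE] : q * g %| pullback A (line_form_coefs L Q).
  by rewrite Gauss_dvdp ?qv // coprimep_sym.
have qg0 : q * g != 0 by rewrite mulf_neq0 ?monic_neq0.
have : (size h <= 1)%N.
  have [->|h0] := eqVneq h 0; first by rewrite size_poly0.
  have := size_pullback A (line_form_coefs L Q).
  by rewrite hE size_mul // size_mul ?monic_neq0 // sq sg; move: (size h) => s; lia.
by move=> /size1_polyC h1; exists h`_0; rewrite hE {1}h1 mul_polyC.
Qed.

(* Modulo [q], a binary form is determined by two coefficients, so that all the
   alternating forms that only depend on classes modulo [q] are proportional. *)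
Lemma alternating_mod_quadratic Q q : cut_out Q q -> exists t,
  forall u v : 'cV_k.+4,
  (row 0 Q *m u) 0 0 * (row 1 Q *m v) 0 0 - (row 1 Q *m u) 0 0 * (row 0 Q *m v) 0 0
    = t * mod_bracket q (pullback A u) (pullback A v).
Proof.
move=> [mq sq qM]; pose c (p : {poly F}) : 'cV_k.+4 := invmx A *m (poly_rV p)^T.
have rowE i v : (row i Q *m v) 0 0 =
    (pullback A v %% q)`_0 * (row i Q *m c 1) 0 0
    + (pullback A v %% q)`_1 * (row i Q *m c 'X) 0 0.
  set r := pullback A v %% q.
  have r2 : (size r <= 2)%N by rewrite -ltnS -sq ltn_modp monic_neq0.
  have /qM Qv : q %| pullback A (v - (r`_0 *: c 1 + r`_1 *: c 'X)).
    rewrite linearB linearD !linearZ /= !pullback_inv ?size_poly1 ?size_polyX //.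
    rewrite alg_polyC -mul_polyC -size2_poly // {1}(divp_eq (pullback A v) q) addrK.
    exact: dvdp_mull.
  have QE : Q *m v = Q *m (r`_0 *: c 1 + r`_1 *: c 'X).
    by apply/eqP; rewrite -subr_eq0 -mulmxBr Qv.
  rewrite -!row_mul QE mulmxDr -!scalemxAr.
  by move: (Q *m c 1) (Q *m c 'X) => u w; rewrite !mxE.
(* The value of the alternating form on the forms that pull back to 1 and ['X]. *)
exists ((row 0 Q *m c 1) 0 0 * (row 1 Q *m c 'X) 0 0
  - (row 1 Q *m c 1) 0 0 * (row 0 Q *m c 'X) 0 0) => u v.
by rewrite (rowE 0 u) (rowE 1 u) (rowE 0 v) (rowE 1 v) /mod_bracket; ring.
Qed.

Lemma obstruction_eq0 L1 L2 g1 g2 Q1 Q2 Q3 q1 q2 q3 :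
  cut_out L1 g1 -> cut_out L2 g2 ->
  cut_out Q1 q1 -> cut_out Q2 q2 -> cut_out Q3 q3 ->
  obstruction L1 L2 Q1 Q2 Q3 = 0.
Proof.
(* Assuming the obstruction nonzero provides the independence required by [pullback_line_form]. *)
move=> L1g L2g Qq1 Qq2 Qq3; apply/eqP/contraT => ob.
(* [a] depends only on [Q]; [t] and the bracket of [g2] and [g1] depend only on [Q']. Both products
   contain each of these factors once per line, and their resultants agree by symmetry. *)
have side Q q : cut_out Q q -> row_free (col_mx Q L1) /\ row_free (col_mx Q L2) ->
  exists a, forall Q' q' t, q' \is monic -> size q' = 3%N ->
    (forall u v : 'cV_k.+4, (row 0 Q' *m u) 0 0 * (row 1 Q' *m v) 0 0
      - (row 1 Q' *m u) 0 0 * (row 0 Q' *m v) 0 0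
      = t * mod_bracket q' (pullback A u) (pullback A v)) ->
    line_bracket L1 L2 Q' Q = a * quad_res q' q * (t * mod_bracket q' g2 g1).
  move=> Qq [Q1free Q2free]; have [mq sq _] := Qq.
  have [a1 E1] := pullback_line_form Q1free L1g Qq.
  have [a2 E2] := pullback_line_form Q2free L2g Qq.
  exists (a1 * a2) => Q' q' t mq' sq' tE.
  rewrite /line_bracket !line_formE tE E1 E2.
  have -> : mod_bracket q' (a2 *: (q * g2)) (a1 *: (q * g1)) =
      a1 * a2 * mod_bracket q' (q * g2) (q * g1).
    by rewrite /mod_bracket !modpZl !coefZ; ring.
  by rewrite mod_bracket_mul //; ring.
case: (obstruction_row_free ob).
move=> /(side _ _ Qq1)[a1 E1] /(side _ _ Qq2)[a2 E2] /(side _ _ Qq3)[a3 E3].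
have [t1 T1] := alternating_mod_quadratic Qq1.
have [t2 T2] := alternating_mod_quadratic Qq2.
have [t3 T3] := alternating_mod_quadratic Qq3.
have [[m1 s1 _] [m2 s2 _] [m3 s3 _]] := And3 Qq1 Qq2 Qq3.
case/eqP: ob; rewrite /obstruction.
rewrite (E3 _ _ _ m1 s1 T1) (E1 _ _ _ m2 s2 T2) (E2 _ _ _ m3 s3 T3).
rewrite (E2 _ _ _ m1 s1 T1) (E3 _ _ _ m2 s2 T2) (E1 _ _ _ m3 s3 T3).
rewrite (quad_resC q2 q1) (quad_resC q3 q1) (quad_resC q3 q2).
by ring.
Qed.

End Relation.

Lemma secant_obstruction (F : numClosedFieldType) k (L1 L2 : 'M[F]_(k.+1, k.+4))
    (Q1 Q2 Q3 : 'M[F]_(2, k.+4)) (X : 'rV[F]_k.+4 -> Prop) :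
  let secant d (M : 'M[F]_(d.+1, k.+4)) := row_free M /\
    @cap_degree F k.+3 X (linear_points <<[seq row i M | i : 'I_d.+1]>>%VS) d.+1 in
  @rational_normal_curve F k.+3 X ->
  secant _ L1 -> secant _ L2 -> secant _ Q1 -> secant _ Q2 -> secant _ Q3 ->
  obstruction L1 L2 Q1 Q2 Q3 = 0.
Proof.
move=> secant [A uA XA] sL1 sL2 sQ1 sQ2 sQ3.
have [p1 p1_0 av1] := veronese_avoids (n := k.+3) L1 uA (leqW (leqnSn _)).
have [p2 p2_0 av2] := veronese_avoids (n := k.+3) L2 uA (leqW (leqnSn _)).
have [p3 p3_0 av3] := veronese_avoids (n := k.+3) Q1 uA isT.
have [p4 p4_0 av4] := veronese_avoids (n := k.+3) Q2 uA isT.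
have [p5 p5_0 av5] := veronese_avoids (n := k.+3) Q3 uA isT.
(* A common nonroot [c] gives, for each of the five components, an equation nonzero at the point (c
   : 1) of the curve. *)
have [|c] := @poly_nonroot _ (p1 * p2 * p3 * p4 * p5).
  by rewrite !mulf_neq0.
rewrite !hornerM !mulf_eq0 !negb_or -!andbA => /and5P[c1 c2 c3 c4 c5].
have [B [uB AB rowB]] := curve_reparam c uA.
have XB x : X x <-> @curve F k.+3 B x by rewrite XA; exact: AB.
have cut d (M : 'M[F]_(d.+1, k.+4)) : secant d M ->
    (exists2 v : 'cV_k.+4, M *m v = 0 & (veronese k.+3 c 1 *m A *m v) 0 0 != 0) ->
    exists g, cut_out B M g.
  move=> [freeM degM] [v Mv]; rewrite -rowB -row_mul mxE => vinf.
  exact: (secant_equation uB XB Mv vinf freeM degM).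
have [g1 cg1] := cut _ _ sL1 (av1 _ c1).
have [g2 cg2] := cut _ _ sL2 (av2 _ c2).
have [q1 cq1] := cut _ _ sQ1 (av3 _ c3).
have [q2 cq2] := cut _ _ sQ2 (av4 _ c4).
have [q3 cq3] := cut _ _ sQ3 (av5 _ c5).
exact: (obstruction_eq0 uB cg1 cg2 cq1 cq2 cq3).
Qed.

(** * A configuration with nonzero obstruction *)

Lemma map_obstruction (R S : comNzRingType) (f : {rmorphism R -> S}) k
    (L1 L2 : 'M[R]_(k.+1, k.+4)) Q1 Q2 Q3 :
  obstruction (map_mx f L1) (map_mx f L2) (map_mx f Q1) (map_mx f Q2) (map_mx f Q3)
  = f (obstruction L1 L2 Q1 Q2 Q3).
Proof.
have fE L Q z : line_form (map_mx f L) (map_mx f Q) (map_mx f z) = f (line_form L Q z).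
  by rewrite /line_form -det_map_mx !map_col_mx.
by rewrite /obstruction /line_bracket -!map_row !fE !(rmorphB, rmorphM).
Qed.

Section Example.
Variables (R : comNzRingType).

(** The columns of [P] are equations of the space spanned by [row_mx N 1%:M], so [P] projects from
    it onto a plane. [E] completes [P] to a matrix of determinant 1 that makes the large matrix
    block triangular. *)
Lemma line_form_proj k (N : 'M[R]_(k.+1, 3)) (Q : 'M_(2, k.+4)) (z : 'rV_k.+4)
    (P := col_mx 1%:M (- N) : 'M_(k.+4, 3)) :
  line_form (row_mx N 1%:M : 'M_(k.+1, 3 + k.+1)) Q z
  = \det (col_mx (z *m P) (Q *m P) : 'M_3).
Proof.
pose S := col_mx 0 1%:M : 'M[R]_(3 + k.+1, k.+1).
pose E := row_mx P S : 'M[R]_(3 + k.+1).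
have detE : \det E = 1.
  have -> : E = block_mx 1%:M 0 (- N) 1%:M by rewrite block_mxEh.
  by rewrite det_lblock !det1 mulr1.
pose C : 'M_(1 + (2 + k.+1), 3 + k.+1) :=
  col_mx z (col_mx Q (row_mx N 1%:M : 'M_(k.+1, 3 + k.+1))).
have -> : line_form (row_mx N 1%:M : 'M_(k.+1, 3 + k.+1)) Q z
    = \det (C : 'M_(3 + k.+1)) by [].
rewrite -[LHS]mulr1 -detE -det_mulmx.
have -> : (C : 'M_(3 + k.+1)) *m E =
    block_mx (col_mx (z *m P) (Q *m P) : 'M_3)
      (col_mx (z *m S) (Q *m S) : 'M_(3, k.+1)) 0 1%:M.
  have LE : (row_mx N 1%:M : 'M_(k.+1, 3 + k.+1)) *m E = row_mx 0 1%:M.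
    rewrite mul_mx_row !mul_row_col !(mul1mx, mulmx1, mulmx0, add0r).
    by rewrite subrr.
  transitivity (col_mx (z *m E) (col_mx (Q *m E) (row_mx 0 1%:M : 'M_(k.+1, 3 + k.+1)))).
    have -> : C *m E = col_mx (z *m E) (col_mx (Q *m E) (row_mx 0 1%:M)) by
      rewrite /C !mul_col_mx LE.
    by [].
  rewrite /E !mul_mx_row block_mxEv.
  rewrite (@col_mxA _ 1 2 k.+1) castmx_id; congr col_mx.
  transitivity (block_mx (z *m P) (z *m S) (Q *m P) (Q *m S)); first by rewrite block_mxEv.
  exact (@block_mxEh R 1 2 3 k.+1 (z *m P) (z *m S) (Q *m P) (Q *m S)).
by rewrite det_ublock det1 mulr1.
Qed.

Definition det3 (a : nat -> nat -> R) : R :=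
  a 0%N 0%N * (a 1%N 1%N * a 2%N 2%N - a 1%N 2%N * a 2%N 1%N)
  - a 0%N 1%N * (a 1%N 0%N * a 2%N 2%N - a 1%N 2%N * a 2%N 0%N)
  + a 0%N 2%N * (a 1%N 0%N * a 2%N 1%N - a 1%N 1%N * a 2%N 0%N).

Lemma det_matrix3 (a : nat -> nat -> R) :
  \det (\matrix_(i < 3, j < 3) a i j) = det3 a.
Proof.
rewrite (expand_det_row _ ord0) !big_ord_recl big_ord0 /cofactor.
rewrite !(expand_det_row _ ord0) !big_ord_recl !big_ord0 /cofactor !det_mx11 !mxE.
by rewrite /= /bump /= !(exprS, expr0) /det3; ring.
Qed.

Definition unit_rows (f : nat -> nat) : 'M[R]_(2, 3) :=
  \matrix_(i < 2, j < 3) (j == f i :> nat)%:R.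

Lemma det_unit_rows f g (i : 'I_2) :
  \det (col_mx (row i (unit_rows f)) (unit_rows g) : 'M_3) =
  det3 (fun l j => (j == nth 0%N [:: f i; g 0%N; g 1%N] l)%:R).
Proof.
rewrite -det_matrix3; congr (\det _); apply/matrixP => l j; rewrite [RHS]mxE.
case: (@split_ordP 1 2 l) => l' ->.
  by transitivity (row i (unit_rows f) l' j); [exact: col_mxEu | rewrite !mxE (ord1 l')].
transitivity (unit_rows g l' j); first exact: col_mxEd.
by rewrite mxE; case: l' => -[|[|]].
Qed.

(** Projection from [example_space1] keeps the first block of three coordinates; projection from
    [example_space2] adds the first two blocks. Hence [f] and [g] prescribe the two images
    independently; the room for two blocks comes from [n >= 5]. *)
Definition example_line k (f g : nat -> nat) : 'M[R]_(2, 3 + (3 + k)) :=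
  row_mx (unit_rows f) (row_mx (unit_rows g - unit_rows f) 0).

Definition example_space1 k : 'M[R]_(3 + k, 3 + (3 + k)) := row_mx 0 1%:M.
Definition example_space2 k : 'M[R]_(3 + k, 3 + (3 + k)) :=
  row_mx (- col_mx 1%:M 0) 1%:M.

Lemma example_line_form1 k f g f' g' (i : 'I_2) :
  line_form (example_space1 k : 'M_(k.+2.+1, k.+2.+4)) (example_line k f' g')
    (row i (example_line k f g)) =
  \det (col_mx (row i (unit_rows f)) (unit_rows f') : 'M_3).
Proof.
rewrite (@line_form_proj k.+2 0) -row_mul.
have E a b : example_line k a b *m col_mx 1%:M (- 0) = unit_rows a.
  by rewrite /example_line mul_row_col mulmx1 oppr0 mulmx0 addr0.
by rewrite !E.
Qed.

Lemma example_line_form2 k f g f' g' (i : 'I_2) :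
  line_form (example_space2 k : 'M_(k.+2.+1, k.+2.+4)) (example_line k f' g')
    (row i (example_line k f g)) =
  \det (col_mx (row i (unit_rows g)) (unit_rows g') : 'M_3).
Proof.
rewrite (@line_form_proj k.+2 (- col_mx 1%:M 0 : 'M_(3 + k, 3))) -row_mul.
have E a b : example_line k a b *m
    col_mx 1%:M (- (- col_mx 1%:M 0 : 'M_(3 + k, 3))) = unit_rows b.
  rewrite /example_line mul_row_col mulmx1 opprK mul_row_col mulmx1 mulmx0.
  by rewrite addr0 addrC subrK.
by rewrite !E.
Qed.

(* In each of the two quotient planes the three lines are the sides of the
   coordinate triangle, with the two vertices on each side exchanged from one
   plane to the other. *)
Definition example_side k (j : nat) : 'M[R]_(2, 3 + (3 + k)) :=
  example_line k (fun i => (j + i.+1) %% 3)%N (fun i => (j + 2 - i) %% 3)%N.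

(** A bracket is 1 from a side to the next one in cyclic order and -1 to the previous one, so the
    two triple products are -1 and 1. *)
Lemma example_obstruction k :
  obstruction (example_space1 k : 'M_(k.+2.+1, k.+2.+4)) (example_space2 k)
    (example_side k 0) (example_side k 1) (example_side k 2) = - 2%:R.
Proof.
rewrite /obstruction /line_bracket /example_side.
rewrite !(example_line_form1, example_line_form2) !det_unit_rows /det3 /=.
by ring.
Qed.
End Example.

(** * Generic configurations *)

Lemma span_vbasis_rows (F : fieldType) n d (V : {vspace 'rV[F]_n}) : \dim V = d ->
  <<[seq row i (\matrix_(i < d) (vbasis V)`_i) | i : 'I_d]>>%VS = V.
Proof.
move=> dimV; rewrite -[RHS](span_basis (vbasisP V)); congr (<< _ >>)%VS.
have sV : size (vbasis V) = d by rewrite size_tuple.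
apply: (@eq_from_nth _ 0) => [|i]; first by rewrite size_image card_ord sV.
rewrite size_image card_ord => id.
rewrite (nth_map (Ordinal id)) ?size_enum_ord // rowK.
by rewrite (nth_enum_ord (Ordinal id)).
Qed.

Section Weight.
Variable k : nat.
Local Notation w := (weight_3lines_2codim3 k.+4.+1).

Definition line_component (j : 'I_3) : component w :=
  existT (fun i => 'I_(w i)) (@Ordinal k.+4 1 isT) j.

Fact codim3_ltn : (k.+2 < k.+4)%N. Proof. by []. Qed.

Fact weight_codim3 : 2 = w (Ordinal codim3_ltn).
Proof. by rewrite /weight_3lines_2codim3 /= subSS subSS subSS subn0 eqxx. Qed.

Definition codim3_component (j : 'I_2) : component w :=
  existT (fun i => 'I_(w i)) (Ordinal codim3_ltn) (cast_ord weight_codim3 j).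

Lemma componentP (P : component w -> Type) :
  (forall j, P (line_component j)) -> (forall j, P (codim3_component j)) ->
  forall c, P c.
Proof.
move=> Pl Pc [i a].
have [i1|ni1] := eqVneq (i : nat) 1%N.
  have iE : i = @Ordinal k.+4 1 isT by exact: val_inj.
  by subst i; exact: Pl.
have [i2|ni2] := eqVneq (i : nat) k.+2.
  have iE : i = Ordinal codim3_ltn by exact: val_inj.
  subst i; have := Pc (cast_ord (esym weight_codim3) a).
  by rewrite /codim3_component cast_ordKV.
have w0 : w i = 0%N.
  by rewrite /weight_3lines_2codim3 (negPf ni1) subSS subSS subSS subn0 (negPf ni2).
by suff : (a < 0)%N by []; rewrite -[ltnRHS]w0.
Qed.

(** Row and component indices go through [inord], which avoids casts between types depending on
    [c]. *)
Definition frame_of R (Q : 'I_3 -> 'M[R]_(2, k.+4.+2)) (L : 'I_2 -> 'M[R]_(k.+3, k.+4.+2))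
    (c : component w) : 'M[R]_((pdim c).+1, k.+4.+2) :=
  \matrix_(i, l) if pdim c == 1%N then Q (inord (tagged c)) (inord i) l
                 else L (inord (tagged c)) (inord i) l.

Lemma frame_of_line R Q L j : @frame_of R Q L (line_component j) = Q j.
Proof. by apply/matrixP => i l; rewrite mxE /= !inord_val. Qed.

Lemma frame_of_codim3 R Q L j : @frame_of R Q L (codim3_component j) = L j.
Proof. by apply/matrixP => i l; rewrite mxE /= !inord_val. Qed.

(** Taken over a ring so as to apply also to frames with entries in [{poly F}]. *)
Definition frame_obstruction (R : comNzRingType)
    (M : forall c : component w, 'M[R]_((pdim c).+1, k.+4.+2)) : R :=
  @obstruction R k.+2
    (M (codim3_component (@Ordinal 2 0 isT))) (M (codim3_component (@Ordinal 2 1 isT)))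
    (M (line_component (@Ordinal 3 0 isT))) (M (line_component (@Ordinal 3 1 isT)))
    (M (line_component (@Ordinal 3 2 isT))).

Lemma eq_frame_obstruction (R : comNzRingType)
    (M M' : forall c : component w, 'M[R]_((pdim c).+1, k.+4.+2)) :
  (forall c, M c = M' c) -> frame_obstruction M = frame_obstruction M'.
Proof. by move=> MM'; rewrite /frame_obstruction !MM'. Qed.

Lemma map_frame_obstruction (R S : comNzRingType) (f : {rmorphism R -> S})
    (M : forall c : component w, 'M[R]_((pdim c).+1, k.+4.+2)) :
  frame_obstruction (fun c => map_mx f (M c)) = f (frame_obstruction M).
Proof. exact: map_obstruction. Qed.

Lemma frame_obstruction_row_free (F : fieldType)
    (M : forall c : component w, 'M[F]_((pdim c).+1, k.+4.+2)) :
  frame_obstruction M != 0 -> forall c, row_free (M c).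
Proof.
move/obstruction_row_free => [[/row_free_col_mx[? ?] /row_free_col_mx[? ?]]
  [/row_free_col_mx[? ?] _] [/row_free_col_mx[? ?] _]].
apply: componentP => -[[|[|[|]]] jlt] //;
  by rewrite (bool_irrelevance jlt isT).
Qed.

Lemma exists_frame_obstruction (F : numFieldType) :
  exists M : forall c : component w, 'M[F]_((pdim c).+1, k.+4.+2),
  frame_obstruction M != 0.
Proof.
pose L (j : 'I_2) := if j == 0 :> nat then example_space1 F k else example_space2 F k.
exists (frame_of (fun j : 'I_3 => example_side F k j) L).
rewrite /frame_obstruction !frame_of_line !frame_of_codim3 example_obstruction.
by rewrite oppr_eq0 pnatr_eq0.
Qed.

Lemma frame_obstruction_eq0 (F : numClosedFieldType) (M : frame F w)
    (Lam : configuration F w) :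
  spans M Lam -> (forall c, row_free (M c)) -> feasible_configuration Lam ->
  frame_obstruction M = 0.
Proof.
move=> ML freeM [C rnC degC].
have secant c : row_free (M c) /\
    cap_degree C (linear_points <<[seq row i (M c) | i : 'I_(pdim c).+1]>>%VS)
      (pdim c).+1.
  by split=> //; rewrite ML.
exact: (@secant_obstruction F k.+2 _ _ _ _ _ C rnC
  (secant (codim3_component (@Ordinal 2 0 isT)))
  (secant (codim3_component (@Ordinal 2 1 isT)))
  (secant (line_component (@Ordinal 3 0 isT)))
  (secant (line_component (@Ordinal 3 1 isT)))
  (secant (line_component (@Ordinal 3 2 isT)))).
Qed.

End Weight.

(** A line of frames joins one over the open set to one with nonzero obstruction. Membership in the
    open set and nonvanishing of the obstruction are each ensured by a nonzero polynomial in the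
    parameter, so both hold at some [t], against feasibility. *)
Lemma generic_not_feasible (F : numClosedFieldType) k :
  non_feasible F (weight_3lines_2codim3 k.+4.+1).
Proof.
set w := weight_3lines_2codim3 _; case=> U [[P openU] [Lam0 U0] feasU].
have [M0 M0L] : exists M0, spans M0 Lam0.
  exists (fun c => \matrix_(i < (pdim c).+1) (vbasis (val (Lam0 c)))`_i) => c.
  by apply: span_vbasis_rows; exact/eqP/(valP (Lam0 c)).
have [f Pf f0] := (openU _ _ M0L).1 U0.
have [M1 ob1] := exists_frame_obstruction k F.
pose Mt t : frame F w := fun c => M0 c + t *: (M1 c - M0 c).
(* The same line of frames, with the parameter as an indeterminate. *)
pose MX (c : component w) : 'M[{poly F}]_((pdim c).+1, k.+4.+2) :=
  map_mx polyC (M0 c) + 'X *: map_mx polyC (M1 c - M0 c).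
have MXt t c i j : (MX c i j).[t] = Mt t c i j.
  by rewrite !mxE hornerD hornerM hornerX !hornerC.
pose fX := mmap (@polyC F)
  (fun e : 'I_#|entry w| => let: existT c ij := enum_val e in MX c ij.1 ij.2) f.
have fXt t : fX.[t] = f.@[coordinates (Mt t)].
  rewrite /fX horner_mmap; apply: meval_eq => e; rewrite /coordinates.
  by case: (enum_val e) => c ij; exact: MXt.
have obXt t : (frame_obstruction MX).[t] = frame_obstruction (Mt t).
  rewrite -[LHS]/(horner_eval t _) -map_frame_obstruction.
  by apply: eq_frame_obstruction => c; apply/matrixP => i j; rewrite [LHS]mxE; exact: MXt.
(* The first factor is nonzero at 0, the second at 1. *)
have [|t] := @poly_nonroot _ (fX * frame_obstruction MX).
  rewrite mulf_neq0 //.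
    apply: contraNneq f0 => fX0; rewrite -(meval_eq (v1 := coordinates (Mt 0))).
      by rewrite -fXt fX0 horner0.
    move=> e; rewrite /coordinates; case: (enum_val e) => c ij.
    by rewrite /Mt scale0r addr0.
  apply: contraNneq ob1 => obX0.
  apply/eqP; rewrite -(eq_frame_obstruction (M := Mt 1)).
    by rewrite -obXt obX0 horner0.
  by move=> c; rewrite /Mt scale1r addrC subrK.
rewrite hornerM mulf_eq0 negb_or fXt obXt => /andP[ft obt].
(* Independence of the rows gives the spans the dimensions required of a configuration. *)
have freeM := frame_obstruction_row_free obt.
pose Lamt : configuration F w := fun c =>
  exist _ <<[seq row i (Mt t c) | i : 'I_(pdim c).+1]>>%VS (dim_span_rows (freeM c)).
have MtL : spans (Mt t) Lamt by [].
have Ut : U Lamt by apply/(openU _ _ MtL); exists f.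
by rewrite (frame_obstruction_eq0 MtL freeM (feasU _ Ut)) eqxx in obt.
Qed.

Theorem proposition5p4 (R : realType) (n : nat) (hn : (5 <= n)%N) :
  non_feasible (R[i])%C (weight_3lines_2codim3 n).
Proof.
case: n hn => [|[|[|[|[|k]]]]] // _.
exact: generic_not_feasible.
Qed.
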